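(* Let $r\ge 1$ be an integer and let $T$ be a (finite) tree with $|V(T)|\ge r+1$. A vertex $v\in V(T)$ is a shedding vertex of $\mathrm{Ind}_r(T)$ if and only if, when $T$ is viewed as rooted at $v$, there exists a subset $A\subseteq \mathrm{Ch}(v)$ such that $|V(T_u)|\le r$ for every $u\in A$ and $$\Big|\Big(\bigsqcup_{u\in A}V(T_u)\Big)\cup\{v\}\Big|\ge r+1 .$$
   Context: Graphs are finite and simple. For a graph $G$ and $A\subseteq V(G)$, $G[A]$ denotes the induced subgraph on $A$. A tree is a connected graph in which there is a unique path between every pair of distinct vertices. For a tree $T$ rooted at $v$: the parent of a vertex $u\ne v$ is the neighbour of $u$ on the unique path from $u$ to $v$, and $u$ is then a child of its parent; $\mathrm{Ch}(u)$ is the set of children of $u$. A vertex $w$ is a descendant of $u$ if $u$ lies on the unique path from the root $v$ to $w$. The rooted subtree $T_u$ is the subtree of $T$ induced by $u$ together with all descendants of $u$, rooted at $u$. For an integer $r\ge 1$, a subset $A\subseteq V(G)$ is $r$-independent if every connected component of $G[A]$ has at most $r$ vertices. The $r$-independence complex $\mathrm{Ind}_r(G)$ is the simplicial complex whose faces are all $r$-independent subsets of $V(G)$. Facets of a simplicial complex are its inclusion-maximal faces. For a vertex $v$ of a simplicial complex $\Delta$, $\mathrm{del}_\Delta(v)=\{F\in\Delta: v\notin F\}$. The vertex $v$ is a shedding vertex of $\Delta$ if every facet of $\mathrm{del}_\Delta(v)$ is a facet of $\Delta$; equivalently, for every facet $F$ of $\mathrm{del}_\Delta(v)$, $F\cup\{v\}$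 is not a face of $\Delta$. *)

(* Defs.v *)
From mathcomp Require Import all_boot.

Set Implicit Arguments.
Unset Strict Implicit.
Unset Printing Implicit Defensive.

Section Graphs.

Variables (V : finType) (e : rel V).

Definition simple_graph : Prop := symmetric e /\ irreflexive e.

(* As in MathComp, the path from [x] to [y] is the sequence [x :: p]. *)
Definition is_path (x y : V) (p : seq V) : bool :=
  [&& path e x p, last x p == y & uniq (x :: p)].

Definition is_tree : Prop :=
  [/\ simple_graph,
      forall x y : V, connect e x y
    & forall x y : V, x != y -> exists! p : seq V, is_path x y p].

(* [z] lies on a path from [x] to [y], which in a tree is the unique one.
   Since a path has no repeated vertex, bounding its length by [#|V|] loses
   nothing (see [on_pathP]) and makes the predicate boolean. *)
Definition on_path (x y z : V) : bool :=
  [exists p : {bseq #|V| of V}, is_path x y p && (z \in x :: p)].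

Lemma on_pathP (x y z : V) :
  reflect (exists2 p : seq V, is_path x y p & z \in x :: p) (on_path x y z).
Proof.
apply: (iffP existsP) => [[p /andP[xy_p p_z]]|[p xy_p p_z]]; first by exists p.
have szp : size p <= #|V|.
  by case/and3P: xy_p => _ _ /card_uniqP def_sz; rewrite ltnW // -[_.+1]def_sz max_card.
by exists (Bseq szp); rewrite xy_p.
Qed.

(* The graph [G[A]], with the vertices outside [A] kept as isolated points. *)
Definition induced (A : {set V}) : rel V :=
  [rel x y | [&& x \in A, y \in A & e x y]].

Definition components (A : {set V}) : {set {set V}} :=
  [set [set y in A | connect (induced A) x y] | x in A].

Definition r_independent (r : nat) (A : {set V}) : bool :=
  [forall C in components A, #|C| <= r].

Definition Ind (r : nat) : {set {set V}} := [set A | r_independent r A].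

Section Rooted.

Variable v : V.

(* [w] is the parent of [u] in the tree rooted at [v]. *)
Definition is_parent (u w : V) : bool :=
  [&& u != v, e u w & on_path u v w].

Definition Ch (u : V) : {set V} := [set w | is_parent w u].

Definition descendants (u : V) : {set V} := [set w | on_path v w u].

(* The vertex set of the rooted subtree [T_u]. *)
Definition subtree (u : V) : {set V} := u |: descendants u.

End Rooted.

End Graphs.

Section Complexes.

(* A simplicial complex is given by its set of faces. *)
Variables (V : finType) (D : {set {set V}}).

Definition facets : {set {set V}} := [set F | maxset [pred B | B \in D] F].

Definition del (v : V) : {set {set V}} := [set F in D | v \notin F].

End Complexes.

Definition shedding (V : finType) (D : {set {set V}}) (v : V) : bool :=
  ([set v] \in D) && (facets (del D v) \subset facets D).

(* Main.v *)
Require Import Defs.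
From mathcomp Require Import all_boot.

(* Write [T_u] for the branches at [v], i.e. the components of [T - v].  If a
   facet [F] of the deletion had [F + v] as a face, then every branch of size at
   most [r] would lie inside [F] (otherwise [F] together with that branch is a
   larger face avoiding [v]), hence inside the component of [v] in [F + v]; so
   the small branches together with [v] have at most [r] vertices.  Conversely,
   when they do, fill all small branches and, in each big branch [T_u], take a
   connected set of [r + 1] vertices containing [u], minus [u] itself.  No facet
   of the deletion above this set contains the root of a big branch, so adding
   [v] to such a facet only creates a component of size at most [r]. *)

(** * Reachability and connected sets of prescribed size *)

Lemma connect_stable (T : finType) (R : rel T) (S : {set T}) (x y : T) :
  x \in S -> (forall a b, a \in S -> R a b -> b \in S) -> connect R x y ->
  y \in S.
Proof.
move=> xS clS /connectP[p xp ->]; elim: p x xS xp => //= z p IHp x xS.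
by case/andP=> /clS zS /IHp; apply; apply: zS.
Qed.

(** [K] grows one vertex at a time: if no edge left [K], it would contain everything reachable from
    [x], which is too much for its size. *)
Lemma connected_subset (T : finType) (R : rel T) (x : T) (k : nat) :
  k < #|[set y | connect R x y]| ->
  exists K : {set T},
    [/\ x \in K, #|K| = k.+1, K \subset [set y | connect R x y]
      & forall y, y \in K ->
          connect [rel a b | [&& a \in K, b \in K & R a b]] x y].
Proof.
elim: k => [_|k IHk lt_k].
  exists [set x]; split; rewrite ?set11 ?cards1 ?sub1set ?inE //.
  by move=> y /set1P ->.
have [K [xK cardK sKC conK]] := IHk (ltnW lt_k).
have [/exists_inP[a aK /exists_inP[b bK Rab]]|exitN] :=
  boolP [exists (a | a \in K), exists (b | b \notin K), R a b].
  exists (b |: K); split.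
  - by rewrite !inE xK orbT.
  - by rewrite cardsU1 bK cardK.
  - rewrite subUset sub1set sKC andbT inE.
    by have := subsetP sKC a aK; rewrite inE => /connect_trans; apply; apply: connect1.
  have conK' y : y \in K ->
      connect [rel c d | [&& c \in b |: K, d \in b |: K & R c d]] x y.
    move/conK; apply: connect_sub => c d /and3P[cK dK Rcd]; apply: connect1.
    by rewrite /= !inE cK dK Rcd !orbT.
  move=> y /setU1P[->|/conK' //]; apply: connect_trans (conK' a aK) (connect1 _).
  by rewrite /= !inE aK eqxx Rab orbT.
suff sCK : [set y | connect R x y] \subset K.
  by have := leq_trans lt_k (subset_leq_card sCK); rewrite cardK ltnn.
apply/subsetP=> y; rewrite inE; apply: connect_stable => // a b aK Rab.
apply: contraR exitN => bK.
by apply/exists_inP; exists a => //; apply/exists_inP; exists b.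
Qed.

Lemma inducedE (V : finType) (e : rel V) (A : {set V}) (x y : V) :
  induced e A x y = [&& x \in A, y \in A & e x y].
Proof. by []. Qed.

(** * Checking [r]-independence piece by piece *)

Section Independence.

Variables (V : finType) (e : rel V) (r : nat).
Implicit Types A B S : {set V}.

(** For symmetric [e], this makes [A :&: S] a union of components of the graph induced on [A]. [S]
    may stick out of [A], so that whole branches can serve as [S]. *)
Definition closed_in A S : Prop :=
  forall y z, y \in A -> y \in S -> z \in A -> e y z -> z \in S.

Lemma r_independentP A :
  reflect (forall x, x \in A -> #|[set y in A | connect (induced e A) x y]| <= r)
          (r_independent e r A).
Proof.
apply: (iffP forall_inP) => [indA x xA | indA C /imsetP[x xA ->]]; last exact: indA.
by apply: indA; apply: imset_f.
Qed.

Lemma component_closed A S x :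
  closed_in A S -> x \in A -> x \in S ->
  [set y in A | connect (induced e A) x y]
    \subset [set y in A :&: S | connect (induced e (A :&: S)) x y].
Proof.
move=> clS xA xS; apply/subsetP=> y; rewrite inE => /andP[_].
apply: connect_stable => [|a b]; first by rewrite !inE xA xS connect0.
rewrite inE => /andP[/setIP[aA aS] xa] /and3P[_ bA eab].
have bS := clS a b aA aS bA eab.
rewrite !inE bA bS; apply: connect_trans xa (connect1 _).
by rewrite inducedE !inE aA aS bA bS.
Qed.

(** [S] may vary with [x]: a path in [A] that starts in [S] never leaves it, so the component of [x]
    is already seen in [A :&: S]. *)
Lemma r_independent_local A :
  (forall x, x \in A ->
     exists S, [/\ x \in S, closed_in A S & r_independent e r (A :&: S)]) ->
  r_independent e r A.
Proof.
move=> locA; apply/r_independentP=> x xA.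
have [S [xS clS /r_independentP/(_ x)]] := locA x xA.
rewrite in_setI xA xS => /(_ isT); apply: leq_trans.
exact/subset_leq_card/component_closed.
Qed.

Lemma r_independentW A B :
  A \subset B -> r_independent e r B -> r_independent e r A.
Proof.
move=> sAB /r_independentP indB; apply/r_independentP=> x xA.
apply: leq_trans (indB x (subsetP sAB x xA)); apply/subset_leq_card/subsetP=> y.
rewrite !inE => /andP[/(subsetP sAB) -> /=]; apply: connect_sub => a b.
case/and3P=> /(subsetP sAB) aB /(subsetP sAB) bB eab.
by apply: connect1; rewrite inducedE aB bB.
Qed.

Lemma r_independent_small A : #|A| <= r -> r_independent e r A.
Proof.
move=> leAr; apply/r_independentP=> x _; apply: leq_trans leAr.
by apply/subset_leq_card/subsetP=> y; rewrite inE => /andP[].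
Qed.

Lemma r_independent_split A S :
  symmetric e -> closed_in A S -> r_independent e r (A :&: S) ->
  r_independent e r (A :\: S) -> r_independent e r A.
Proof.
move=> sym_e clS indS indC; apply: r_independent_local => x xA.
have [xS|xNS] := boolP (x \in S); first by exists S.
(* By symmetry of [e], the complement of [S] is closed in [A] too. *)
exists (~: S); split; rewrite -?setDE ?inE // => y z yA yNS zA eyz.
rewrite !inE in yNS *; apply: contra yNS => zS.
by apply: clS zA zS yA _; rewrite sym_e.
Qed.

Lemma connected_dependent A x :
  x \in A -> r < #|A| -> (forall y, y \in A -> connect (induced e A) x y) ->
  ~~ r_independent e r A.
Proof.
move=> xA ltrA conA; apply/negP=> /r_independentP/(_ x xA).
rewrite leqNgt (leq_trans ltrA) // subset_leq_card //.
by apply/subsetP=> y yA; rewrite inE yA conA.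
Qed.

End Independence.

(** * Branches of the tree at the root [v] *)

Section Branches.

Variables (V : finType) (e : rel V) (v : V).
Hypothesis tree_e : is_tree e.

Let sym_e : symmetric e. Proof. by case: tree_e => -[]. Qed.

Let adj_neq u w : e u w -> u != w.
Proof. by case: tree_e => -[_ irr] _ _; apply: contraTneq => ->; rewrite irr. Qed.

Lemma tree_path_edge u p : e v u -> is_path e v u p -> p = [:: u].
Proof.
move=> evu vup; case: tree_e => _ _ /(_ v u (adj_neq _ _ evu))[q [_ uniq_q]].
rewrite -(uniq_q _ vup); apply: uniq_q.
by rewrite /is_path /= evu eqxx inE adj_neq.
Qed.

Lemma ChE u : (u \in Ch e v v) = e v u.
Proof.
rewrite inE /is_parent (sym_e u); apply/and3P/idP=> [[]//|evu].
have uv : u != v by rewrite eq_sym adj_neq.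
split=> //; apply/on_pathP; exists [:: v]; last by rewrite !inE eqxx orbT.
by rewrite /is_path /= sym_e evu eqxx inE uv.
Qed.

(** A path from [v] through [u] must start with the edge to [u], and its tail then avoids [v].
    Conversely, [v] can be put in front of any simple path from [u] that avoids it. *)
Lemma subtreeE u :
  e v u -> subtree e v u = [set x | connect (induced e [set~ v]) u x].
Proof.
move=> evu; apply/setP=> x; rewrite !inE; apply/orP/idP.
  case=> [/eqP-> // | /on_pathP[p /and3P[]]].
  rewrite inE [u == v]eq_sym (negPf (adj_neq _ _ evu)) orFb => vp lastp Up pu.
  case/splitPr: pu vp lastp Up => p1 p2; rewrite -cat_rcons.
  rewrite cat_path last_cat last_rcons -cat_cons cat_uniq.
  case/andP=> vp1 up2 /eqP<- /and3P[Up1 dis12 Up2].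
  have def_p1 : rcons p1 u = [:: u].
    by apply: tree_path_edge; rewrite // /is_path vp1 last_rcons eqxx.
  rewrite def_p1 in dis12.
  apply/connectP; exists p2 => //; move: up2.
  apply: (sub_in_path (P := fun y => y \in [set~ v])).
    by move=> a b aV bV eab; rewrite inducedE aV bV.
  apply/allP=> y; rewrite !inE => /predU1P[->|yp2].
    by rewrite eq_sym adj_neq.
  by apply: contraNneq dis12 => <-; apply/hasP; exists y; rewrite ?inE ?eqxx.
case/connectP=> p0 up0 ->; case/shortenP: up0 => p up Up _; right.
apply/on_pathP; exists (u :: p); last by rewrite !inE eqxx orbT.
rewrite /is_path /= evu eqxx inE negb_or adj_neq //=.
have -> : path e u p by apply: sub_path up => a b /and3P[].
move: Up => /= -> /=; rewrite andbT.
(* What is left is [v \notin p]: every step of [p] ends outside [v]. *)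
elim: p u {evu p0} up => //= z p IHp u /andP[/and3P[_ zv _] /IHp vp].
by rewrite inE negb_or vp andbT eq_sym; rewrite !inE in zv.
Qed.

Lemma subtree_refl u : u \in subtree e v u.
Proof. by rewrite !inE eqxx. Qed.

Lemma subtree_root u : e v u -> v \notin subtree e v u.
Proof.
move=> evu; rewrite subtreeE // inE; apply/negP.
suff sub x : connect (induced e [set~ v]) u x -> x \in [set~ v].
  by move/sub; rewrite !inE eqxx.
apply: connect_stable => [|a b _ /and3P[] //].
by rewrite !inE eq_sym adj_neq.
Qed.

(** The only exit from a branch is [v], so branches are [closed_in] every set that avoids [v]. *)
Lemma subtree_step u y z :
  e v u -> y \in subtree e v u -> e y z -> z != v -> z \in subtree e v u.
Proof.
move=> evu yu eyz zv.
have yv : y != v by apply: contraTneq yu => ->; apply: subtree_root.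
move: yu; rewrite subtreeE // !inE => /connect_trans; apply; apply: connect1.
by rewrite inducedE !inE yv zv.
Qed.

(** Through [x], the root [w] falls in the branch at [u], so [u] lies on a path from [v] to [w];
    that path is a single edge. *)
Lemma subtree_disjoint u w x :
  e v u -> e v w -> x \in subtree e v u -> x \in subtree e v w -> u = w.
Proof.
move=> evu evw; rewrite !subtreeE // !inE => ux wx.
have ind_sym : connect_sym (induced e [set~ v]).
  apply: sym_connect_sym => a b.
  by rewrite !inducedE sym_e andbCA.
have : w \in subtree e v u.
  by rewrite subtreeE // inE (connect_trans ux) // ind_sym.
rewrite in_setU1 inE => /predU1P[-> // | /on_pathP[p vwp]].
rewrite (tree_path_edge w p evw vwp) !inE eq_sym (negPf (adj_neq _ _ evu)) /=.
by move/eqP.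
Qed.

(** * Facets of the deletion of [v] *)

Variable r : nat.

(* The trace on the branch at [u] of the facets used for necessity. *)
Lemma branch_trace u :
  exists X : {set V}, e v u ->
    [/\ X \subset subtree e v u, #|X| <= r,
        #|subtree e v u| <= r -> X = subtree e v u
      & r < #|subtree e v u| -> ~~ r_independent e r (u |: X)].
Proof.
(* The empty set is a dummy value: a trace for every [u] lets [fin_all_exists] choose all of them at
   once. *)
case: (boolP (e v u)) => [evu|]; last by exists set0.
have [small|big] := leqP #|subtree e v u| r.
  by exists (subtree e v u).
have := big; rewrite {1}subtreeE // => /connected_subset[K [uK cardK sK conK]].
exists (K :\ u) => _; split=> // [||_].
- by rewrite subtreeE // (subset_trans _ sK) // subD1set.
- by rewrite -ltnS -cardK (cardsD1 u K) uK.
rewrite setD1K //; apply: connected_dependent uK _ _; first by rewrite cardK.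
move=> y /conK; apply: connect_sub => a b /and3P[aK bK /and3P[_ _ eab]].
by apply: connect1; rewrite inducedE aK bK.
Qed.

Lemma facet_avoiding_face :
  #|(\bigcup_(u | e v u && (#|subtree e v u| <= r)) subtree e v u) :|: [set v]| <= r ->
  exists2 F, F \in facets (del (Ind e r) v) & v |: F \in Ind e r.
Proof.
set S := _ :|: _ => leSr.
have [f fP] := fin_all_exists branch_trace.
pose F0 := \bigcup_(u | e v u) f u.
have F0v : v \notin F0.
  apply/bigcupP=> -[u evu]; apply/negP; apply: contra (subtree_root u evu).
  by case: (fP u evu) => /subsetP sub _ _ _; apply: sub.
(* Without [v], components stay within one branch, and by disjointness [F0] meets the branch at [u]
   only in [f u]. *)
have indF0 : r_independent e r F0.
  apply: r_independent_local => x /bigcupP[u evu fux].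
  have [/subsetP sfu lefur _ _] := fP u evu.
  exists (subtree e v u); split; first exact: sfu.
    move=> y z _ yu zF0 eyz; apply: subtree_step eyz _ => //.
    by apply: contraNneq F0v => <-.
  apply: r_independent_small; apply: leq_trans lefur; apply/subset_leq_card/subsetP=> y.
  case/setIP=> /bigcupP[w evw fwy] yu; have [/subsetP sfw _ _ _] := fP w evw.
  by rewrite (subtree_disjoint _ _ _ evu evw yu (sfw y fwy)).
have delF0 : [pred B | B \in del (Ind e r) v] F0 by rewrite /= !inE indF0.
have [F maxF sF0F] := maxset_exists delF0; exists F; rewrite ?inE //.
have [] := maxsetP maxF; rewrite /= !inE => /andP[indF Fv] _.
(* The root of a big branch would complete its trace, contained in [F], to a dependent set. *)
have rootF z : z \in F -> e v z -> z \in S.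
  move=> zF evz; rewrite inE; apply/orP; left; apply/bigcupP; exists z; last exact: subtree_refl.
  rewrite evz leqNgt; apply/negP=> big; have [_ _ _ /(_ big)/negP] := fP z evz.
  apply; apply: r_independentW indF; rewrite subUset sub1set zF.
  by apply: subset_trans sF0F; apply: bigcup_sup.
(* Edges from [v] into [F] end in [S] by [rootF], so [S] is closed in [v |: F]; outside [S] only
   vertices of [F] remain. *)
apply: (r_independent_split _ _ _ _ S) => //.
- move=> y z _ /setUP[/bigcupP[u /andP[evu small] yu]|/set1P->] /setU1P[->|zF] eyz.
  + by rewrite !inE eqxx orbT.
  + rewrite inE; apply/orP; left; apply/bigcupP; exists u; rewrite ?evu //.
    by apply: subtree_step eyz _ => //; apply: contraNneq Fv => <-.
  + by rewrite !inE eqxx orbT.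
  + exact: rootF.
- by apply: r_independent_small; apply: leq_trans leSr; rewrite subset_leq_card ?subsetIr.
apply: r_independentW indF; apply/subsetP=> y /setDP[/setU1P[->|//]].
by rewrite in_setU set11 orbT.
Qed.

(** As [v] is absent, adding the branch to [F] leaves it separated from the rest, so the union is
    still a face and maximality of [F] applies. *)
Lemma facet_small_subtree F u :
  F \in facets (del (Ind e r) v) -> e v u -> #|subtree e v u| <= r ->
  subtree e v u \subset F.
Proof.
rewrite inE => /maxsetP[]; rewrite /= !inE => /andP[indF Fv] maxF evu small.
have NFv : v \notin F :|: subtree e v u by rewrite in_setU negb_or Fv subtree_root.
rewrite -(maxF (F :|: subtree e v u)) ?subsetUr ?subsetUl //= inE NFv andbT inE.
apply: (r_independent_split _ _ _ _ (subtree e v u)) => //.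
- move=> y z _ yu zF eyz; apply: subtree_step eyz _ => //.
  by apply: contraTneq zF => ->.
- by apply: r_independent_small; apply: leq_trans small; rewrite subset_leq_card ?subsetIr.
by apply: r_independentW indF; rewrite setDUl setDv setU0 subsetDl.
Qed.

(** All these branches hang on [v] through their roots, so they lie in the component of [v] in
    [v |: F]. *)
Lemma small_subtrees_dependent (A F : {set V}) :
  (forall u, u \in A -> e v u /\ subtree e v u \subset F) ->
  r < #|(\bigcup_(u in A) subtree e v u) :|: [set v]| ->
  ~~ r_independent e r (v |: F).
Proof.
move=> AP ltrS; apply: contraL ltrS => indF; rewrite -leqNgt.
have /r_independentP/(_ v) := indF; rewrite setU11 => /(_ isT).
apply: leq_trans; apply/subset_leq_card/subsetP=> x.
case/setUP=> [/bigcupP[u uA]|/set1P->]; last by rewrite inE setU11 /=.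
have [evu /subsetP suF] := AP u uA.
rewrite subtreeE // inE => ux.
(* Membership in the branch is carried along because it is what puts the next vertex in [F]. *)
suff: x \in subtree e v u :&: [set y in v |: F | connect (induced e (v |: F)) v y].
  by case/setIP.
apply: connect_stable ux => [|a b].
  rewrite in_setI subtree_refl inE !in_setU1 (suF u (subtree_refl u)) orbT.
  by apply: connect1; rewrite inducedE setU11 in_setU1 (suF u (subtree_refl u)) orbT.
case/setIP=> au; rewrite inE => /andP[aF va] /and3P[_ bv eab].
have bu : b \in subtree e v u by apply: subtree_step eab _; rewrite // !inE in bv.
have bF : b \in v |: F by rewrite in_setU1 (suF b bu) orbT.
rewrite in_setI bu inE bF; apply: connect_trans va (connect1 _).
by rewrite inducedE aF bF.
Qed.

End Branches.

(** * Comparing facets of the deletion with facets of the complex *)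

Theorem lemma3p1 (V : finType) (e : rel V) (r : nat) (v : V) :
  1 <= r -> is_tree e -> r.+1 <= #|V| ->
  shedding (Ind e r) v <->
  exists A : {set V},
    [/\ A \subset Ch e v v,
        forall u : V, u \in A -> #|subtree e v u| <= r
      & r.+1 <= #|(\bigcup_(u in A) subtree e v u) :|: [set v]|].
Proof.
move=> r_gt0 tree_e _; split=> [/andP[_ /subsetP shed]|[A [/subsetP sACh small big]]].
  (* The largest admissible [A]: the roots of all small branches. *)
  exists [set u | e v u && (#|subtree e v u| <= r)]; split.
  - by apply/subsetP=> u; rewrite ChE // inE => /andP[].
  - by move=> u; rewrite inE => /andP[].
  rewrite ltnNge; apply/negP; rewrite (eq_bigl _ _ (in_set _)).
  case/(facet_avoiding_face _ _ _ tree_e)=> F facF faceF.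
  (* Were [F] a facet of the whole complex, the face [v |: F] would equal [F], which avoids [v]. *)
  have := shed F facF; rewrite inE => /maxsetP[_ /(_ _ faceF (subsetUr _ _)) eqF].
  by move: facF; rewrite inE => /maxsetP[]; rewrite /= !inE -eqF setU11 andbF.
apply/andP; split.
  by rewrite inE; apply: r_independent_small; rewrite cards1.
apply/subsetP=> F facF; have sub u : u \in A -> e v u /\ subtree e v u \subset F.
  move=> uA; have evu : e v u by rewrite -ChE // sACh.
  by split=> //; apply: facet_small_subtree facF evu (small u uA).
have dep := small_subtrees_dependent _ _ _ tree_e _ _ _ sub big.
move: facF; rewrite !inE => /maxsetP[]; rewrite /= !inE => /andP[indF Fv] maxF.
apply/maxsetP; split=> [|B]; rewrite /= inE // => indB sFB.
(* A face above [F] containing [v] would contain the dependent set [v |: F]; hence it lies in the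
   deletion, where [F] is maximal. *)
apply: maxF => //; rewrite !inE indB; apply: contra dep => vB.
by apply: r_independentW indB; rewrite subUset sub1set vB.
Qed.
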